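(* Let $\mathcal{A}$ be a $d$-arrangement of homotopy spheres. Then its intersection lattice $L(\mathcal{A})$ is a geometric lattice with rank function $r(X)=d-\dim X$. If $\mathcal{A}$ is essential, then the rank of $L(\mathcal{A})$ is $d+1$.
   Context: A geometric lattice is a finite ranked lattice $L$ (with least element $\hat 0$ and greatest element $\hat 1$) in which every element other than $\hat 0$ is a join of atoms and whose rank function satisfies $r(X)+r(Y)\ge r(X\wedge Y)+r(X\vee Y)$; its rank is $r(\hat 1)$. A homotopy $k$-sphere is a $k$-dimensional CW-complex homotopy equivalent to the sphere $S^k$; by convention the empty set is a homotopy $(-1)$-sphere (of dimension $-1$). A $d$-arrangement of homotopy spheres consists of a homotopy $d$-sphere $S$ and a finite set $\mathcal{A}=\{S_1,\dots,S_n\}$ of subcomplexes of $S$, each a homotopy $(d-1)$-sphere, such that (a) every intersection of members of $\mathcal{A}$ is a homotopy sphere; (b) if $X$ is an intersection of members of $\mathcal{A}$ which is a $d'$-dimensional homotopy sphere and $X\nsubseteq S_j$, then $X\cap S_j$ is a $(d'-1)$-dimensional homotopy sphere. $\mathcal{A}$ is essential if $\bigcap_jS_j=\emptyset$. The intersection lattice $L(\mathcal{A})$ is the poset of all intersections of members of $\mathcal{A}$, ordered by reverse inclusion, with $S$ included as the empty intersection. *)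

(* Defs.v *)
From HB Require Import structures.
From mathcomp Require Import all_boot all_order all_algebra.
From mathcomp Require Import all_classical all_reals topology.

Set Implicit Arguments.
Unset Strict Implicit.
Unset Printing Implicit Defensive.

Import Order.TTheory GRing.Theory Num.Theory.
Import numFieldTopology.Exports.

Local Open Scope classical_set_scope.
Local Open Scope ring_scope.

(* The library's norm on row vectors is the sup norm, which induces the same
   topology; disks and spheres are cut out by the Euclidean norm instead. *)
Definition sqnorm (R : realType) (n : nat) (x : 'rV[R]_n) : R :=
  \sum_(i < n) x 0 i ^+ 2.

Definition closed_disk (R : realType) (n : nat) : set 'rV[R]_n :=
  [set x | sqnorm x <= 1].

Definition open_disk (R : realType) (n : nat) : set 'rV[R]_n :=
  [set x | sqnorm x < 1].

(* The boundary of the n-disk, so S^k is [unit_sphere R k.+1]. *)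
Definition unit_sphere (R : realType) (n : nat) : set 'rV[R]_n :=
  [set x | sqnorm x = 1].

Arguments closed_disk R n : clear implicits.
Arguments open_disk R n : clear implicits.
Arguments unit_sphere R n : clear implicits.

Definition homotopic (R : realType) (X Y : topologicalType) (f g : X -> Y) :
    Prop :=
  exists2 H : X * R -> Y,
    {within [set: X] `*` `[0, 1], continuous H} &
    forall x, H (x, 0) = f x /\ H (x, 1) = g x.

Definition homotopy_equivalent (R : realType) (X Y : topologicalType) : Prop :=
  exists (f : X -> Y) (g : Y -> X),
    [/\ continuous f, continuous g,
        homotopic R (g \o f) id & homotopic R (f \o g) id].

Unset Implicit Arguments.

(* The characteristic map of a cell is a total function, but only its values on
   the closed disk are meaningful. *)
Record cw_complex (R : realType) := CWComplex {
  cw_space :> topologicalType;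
  cw_hausdorff : hausdorff_space cw_space;
  cell : Type;
  cell_dim : cell -> nat;
  char_map : forall i : cell, 'rV[R]_(cell_dim i) -> cw_space;
  char_map_continuous : forall i : cell,
    {within closed_disk R (cell_dim i), continuous (char_map i)};
  (* on the open disk, [char_map i] is a homeomorphism onto its image *)
  char_map_homeo : forall i : cell,
    exists2 g : cw_space -> 'rV[R]_(cell_dim i),
      {within char_map i @` open_disk R (cell_dim i), continuous g} &
      forall x, open_disk R (cell_dim i) x -> g (char_map i x) = x;
  cell_partition : forall x : cw_space,
    exists! i : cell, (char_map i @` open_disk R (cell_dim i)) x;
  closure_finite : forall i : cell,
    exists J : set cell,
      [/\ finite_set J, (forall j, J j -> (cell_dim j < cell_dim i)%N) &
          char_map i @` unit_sphere R (cell_dim i) `<=`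
          \bigcup_(j in J) (char_map j @` open_disk R (cell_dim j))];
  weak_topology : forall C : set cw_space,
    (forall i : cell,
       closed (closed_disk R (cell_dim i) `&` char_map i @^-1` C)) ->
    closed C
}.

Set Implicit Arguments.

Arguments cell {R} K : rename.
Arguments cell_dim {R K} i : rename.
Arguments char_map {R K} i x : rename.

Section CWComplexTheory.
Context (R : realType) (K : cw_complex R).

Definition open_cell (i : cell K) : set K := char_map i @` open_disk R (cell_dim i).

Definition closed_cell (i : cell K) : set K :=
  char_map i @` closed_disk R (cell_dim i).

(* A union of cells containing the closure of each of its cells; it is a CW
   complex with the cells it contains. *)
Definition subcomplex (Y : set K) : Prop :=
  forall x, Y x -> exists2 i, open_cell i x & closed_cell i `<=` Y.

Definition cell_dims (Y : set K) : set int :=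
  -1 |` [set (cell_dim i)%:Z | i in [set i | open_cell i `<=` Y]].

(* The dimension is the largest dimension of a cell, and -1 if there is none;
   no [k] qualifies when the dimensions of the cells are unbounded. *)
Definition has_dimension (Y : set K) (k : int) : Prop :=
  cell_dims Y k /\ ubound (cell_dims Y) k.

Definition dimension (Y : set K) : int := xget (-1) (has_dimension Y).

Definition homotopy_sphere (Y : set K) (k : int) : Prop :=
  [/\ subcomplex Y, has_dimension Y k &
      (Y = set0 /\ k = -1) \/
      (exists2 n : nat, k = n%:Z &
         homotopy_equivalent R (set_type Y) (set_type (unit_sphere R n.+1)))].

(* [B = set0] contributes the whole complex, as the empty intersection. *)
Definition intersections (A : set (set K)) : set (set K) :=
  [set \bigcap_(Y in B) Y | B in [set B | B `<=` A]].

(* The ambient homotopy sphere is the whole complex [K]. *)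
Record sphere_arrangement (A : set (set K)) (d : int) : Prop := {
  ambient_sphere : homotopy_sphere [set: K] d;
  finite_arrangement : finite_set A;
  member_sphere : forall Y, A Y -> homotopy_sphere Y (d - 1);
  intersection_sphere : forall X, intersections A X ->
    exists k, homotopy_sphere X k;
  intersection_step : forall X Y k, intersections A X -> A Y ->
    homotopy_sphere X k -> ~ (X `<=` Y) -> homotopy_sphere (X `&` Y) (k - 1)
}.

Definition essential (A : set (set K)) : Prop := \bigcap_(Y in A) Y = set0.

Definition intersection_lattice (A : set (set K)) : Type :=
  {X : set K | X \in intersections A}.

HB.instance Definition _ (A : set (set K)) :=
  SubChoice.on (intersection_lattice A).

Section ReverseInclusion.
Context (A : set (set K)).
Implicit Types X Y Z : intersection_lattice A.

Definition intersection_le X Y : bool := `[< val Y `<=` val X >].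

Lemma intersection_le_refl : reflexive intersection_le.
Proof. by move=> X; apply/asboolP. Qed.

Lemma intersection_le_anti : antisymmetric intersection_le.
Proof.
by move=> X Y /andP[/asboolP YX /asboolP XY]; apply/val_inj/seteqP; split.
Qed.

Lemma intersection_le_trans : transitive intersection_le.
Proof.
move=> Y X Z /asboolP YX /asboolP ZY.
by apply/asboolP; apply: subset_trans ZY YX.
Qed.

End ReverseInclusion.

Fact intersection_display : Order.disp_t. Proof. exact: Order.Disp tt tt. Qed.

HB.instance Definition _ (A : set (set K)) :=
  Order.Le_isPOrder.Build intersection_display (intersection_lattice A)
    (@intersection_le_refl A) (@intersection_le_anti A)
    (@intersection_le_trans A).

End CWComplexTheory.

Section GeometricLattice.
Context (disp : Order.disp_t) (P : porderType disp).

Definition is_least (b : P) : Prop := forall x, (b <= x)%O.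

Definition is_greatest (t : P) : Prop := forall x, (x <= t)%O.

Definition covered_by (x y : P) : Prop :=
  (x < y)%O /\ forall z, ~ (x < z < y)%O.

Definition atom (x : P) : Prop := exists2 b, is_least b & covered_by b x.

Definition rank_function (r : P -> int) : Prop :=
  (forall b, is_least b -> r b = 0) /\
  (forall x y, covered_by x y -> r y = r x + 1).

(* A finite poset with a least element has at most one rank function. *)
Record geometric_lattice (r : P -> int) : Prop := {
  geometric_finite : finite_set [set: P];
  geometric_least : exists b, is_least b;
  geometric_greatest : exists t, is_greatest t;
  geometric_meet : forall x y : P, exists m, infimums [set x; y] m;
  geometric_join : forall x y : P, exists j, supremums [set x; y] j;
  geometric_ranked : rank_function r;
  geometric_atomic : forall x, ~ is_least x ->
    exists2 B : set P, B `<=` atom & supremums B x;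
  geometric_semimodular : forall x y m j : P,
    infimums [set x; y] m -> supremums [set x; y] j ->
    r m + r j <= r x + r y
}.

Definition lattice_rank (r : P -> int) (n : int) : Prop :=
  exists2 t, is_greatest t & r t = n.

End GeometricLattice.

(* Main.v *)
Require Import Defs.
From mathcomp Require Import all_boot all_order all_algebra.
From mathcomp Require Import all_classical all_reals topology.
From mathcomp Require Import zify.

Import Order.TTheory GRing.Theory Num.Theory.

Local Open Scope classical_set_scope.
Local Open Scope ring_scope.

(** Cells enter only to show that a set has at most one dimension and that the
    empty set has dimension [-1]; the rest is about a finite family [A] of
    sets.  The hypothesis on successive intersections says that cutting an
    intersection [X] by a member [S] of [A] lowers the dimension by exactly one
    if [X] is not contained in [S] ([dimension_cut]); otherwise the cut does
    nothing.

    The lattice properties come from this.  If [Y] covers [X] in reverse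
    inclusion, some member [S] containing [Y] does not contain [X], and then
    [Y] is squeezed against [X `&` S], so its dimension is one less: this is
    the rank axiom.  Two members of [A] cannot be strictly nested, since the
    smaller would then be a proper cut of the larger although both have
    dimension [d - 1]; hence the members are atoms ([member_atom]), and every
    intersection is by definition a join of members.  The join of two
    intersections is their set-theoretic intersection, and their meet is the
    intersection of all members of [A] that contain both.

    For semimodularity, suppose [Y `<=` M].  A cut that leaves [M] unchanged
    also leaves [Y] unchanged, so a cut costs [Y] at most what it costs [M];
    iterating, this holds for any finite family of cuts ([dimension_cuts_le]).
    When [M] contains both [X] and [Y], the cuts by the members defining [X]
    bring [M] down to [X] and [Y] down to [X `&` Y]; comparing the costs gives
    the desired inequality.

    The greatest element is the intersection of all members, so if the
    arrangement is essential its rank is [d - (-1)]. *)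

(** * Dimension of sets of cells *)

Section CellularDimension.
Context {R : realType} {K : cw_complex R}.
Implicit Types (X Y : set K) (k : int).

Lemma has_dimensionE Y k : has_dimension Y k -> dimension Y = k.
Proof.
move=> Yk; apply: xget_unique => // l [lY ubl].
case: Yk => kY ubk.
by apply/eqP; rewrite eq_le (ubk _ lY) (ubl _ kY).
Qed.

Lemma homotopy_sphere_dimension {Y k} :
  homotopy_sphere Y k -> dimension Y = k.
Proof. by case=> _ /has_dimensionE. Qed.

Lemma open_cell_neq0 (i : cell K) : open_cell i !=set0.
Proof.
exists (char_map i 0); exists 0 => //.
rewrite /open_disk /= /sqnorm big1 ?ltr01// => j _.
by rewrite mxE expr0n.
Qed.

Lemma dimension0 : dimension (set0 : set K) = -1.
Proof.
apply: has_dimensionE; split; first by left.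
by move=> k [->|[i i0 _]] //; have [x /i0] := open_cell_neq0 i.
Qed.

End CellularDimension.

(** * Intersections of a family of sets *)

Section Intersections.
Context {R : realType} {K : cw_complex R} {A : set (set K)}.

Lemma intersections_bigcap (B : set (set K)) :
  B `<=` A -> intersections A (\bigcap_(Y in B) Y).
Proof. by move=> BA; exists B. Qed.

Lemma intersections_setT : intersections A setT.
Proof. by exists set0 => //; rewrite bigcap_set0. Qed.

Lemma intersections_member Y : A Y -> intersections A Y.
Proof.
by move=> AY; exists [set Y]; [move=> _ -> | rewrite bigcap_set1].
Qed.

Lemma intersections_setI X Y :
  intersections A X -> intersections A Y -> intersections A (X `&` Y).
Proof.
move=> [B BA <-] [C CA <-]; exists (B `|` C); last by rewrite bigcap_setU.
by move=> Z [/BA|/CA].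
Qed.

Lemma intersections_separate X Y : intersections A Y -> ~ X `<=` Y ->
  exists S, [/\ A S, Y `<=` S & ~ X `<=` S].
Proof.
move=> [B BA <-] nXY.
have [S BS nXS] : exists2 S, B S & ~ X `<=` S.
  apply: contra_notP nXY => noS x Xx S BS.
  by apply: contra_notP noS => nSx; exists S => // /(_ x Xx).
by exists S; split=> //; [exact: BA | exact: bigcap_inf].
Qed.

(** An intersection is determined by the set of indices, in an enumeration of
    [A], of the members it is built from. *)
Lemma intersections_finite : finite_set A -> finite_set (intersections A).
Proof.
move=> /finite_seqP[s As].
pose capD (D : {set 'I_(size s)}) := \bigcap_(i in [set` D]) nth setT s i.
apply: (@sub_finite_set _ _ (capD @` setT)); last first.
  exact/finite_image/finite_finset.
move=> _ [B BA <-].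
exists [set i : 'I_(size s) | `[< B (nth setT s i) >]]%SET => //.
apply/seteqP; split=> x /= Bx.
- move=> Y BY; have sY : Y \in s by have := BA _ BY; rewrite As.
  have sYi : (index Y s < size s)%N by rewrite index_mem.
  have /= := Bx (Ordinal sYi); rewrite nth_index//; apply.
  by rewrite inE /= nth_index//; apply/asboolP.
- by move=> i /=; rewrite inE => /asboolP; exact: Bx.
Qed.

End Intersections.

(** * Dimension loss under cuts *)

Section Arrangement.
Context {R : realType} {K : cw_complex R} {d : int} {A : set (set K)}.
Hypothesis hA : sphere_arrangement A d.
Implicit Types X Y Z M S : set K.

Lemma dimension_setT : dimension [set: K] = d.
Proof. exact: homotopy_sphere_dimension (ambient_sphere hA). Qed.

Lemma dimension_member S : A S -> dimension S = d - 1.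
Proof. by move/(member_sphere hA)/homotopy_sphere_dimension. Qed.

Lemma dimension_cut X S : intersections A X -> A S -> ~ X `<=` S ->
  dimension (X `&` S) = dimension X - 1.
Proof.
move=> AX AS nXS; have [k Xk] := intersection_sphere hA AX.
rewrite (homotopy_sphere_dimension Xk).
exact: homotopy_sphere_dimension (intersection_step hA AX AS Xk nXS).
Qed.

(** Members have equal dimension, whereas a proper cut loses one. *)
Lemma member_subset_eq S Y : A S -> A Y -> S `<=` Y -> S = Y.
Proof.
move=> AS AY SY; apply/seteqP; split=> //; apply: contrapT => nYS.
have := dimension_cut _ _ (intersections_member _ AY) AS nYS.
by rewrite setIC (setIidl SY) !dimension_member//; lia.
Qed.

(** Each cost is [0] or [1], and [S] cuts [M] properly whenever it cuts [Y]
    properly. *)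
Lemma dimension_cut_le Y M S : intersections A Y -> intersections A M -> A S ->
  Y `<=` M ->
  dimension Y - dimension (Y `&` S) <= dimension M - dimension (M `&` S).
Proof.
move=> AY AM AS YM.
have [MS|nMS] := pselect (M `<=` S).
  by rewrite (setIidl MS) (setIidl (subset_trans YM MS)) !subrr.
rewrite (dimension_cut M)//.
have [YS|nYS] := pselect (Y `<=` S); first by rewrite (setIidl YS); lia.
by rewrite (dimension_cut Y)//; lia.
Qed.

(** The exchange inequality behind semimodularity: the codimension cost of a
    family of cuts is monotone in the set being cut. *)
Lemma dimension_cuts_le Y M X :
  intersections A Y -> intersections A M -> intersections A X -> Y `<=` M ->
  dimension Y - dimension (Y `&` X) <= dimension M - dimension (M `&` X).
Proof.
move=> AY AM [B BA <-] YM.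
have /finite_seqP[s Bs] := sub_finite_set BA (finite_arrangement hA).
move: BA; rewrite {}Bs bigcap_seq => sA.
elim: s Y M sA AY AM YM => [|S s IH] Y M sA AY AM YM.
  by rewrite big_nil !setIT !subrr.
have AS : A S by apply: sA; rewrite /= mem_head.
rewrite big_cons !setIA.
have := dimension_cut_le _ _ _ AY AM AS YM.
have := IH (Y `&` S) (M `&` S); rewrite /=.
have sA' : [set` s] `<=` A by move=> Z /= sZ; apply: sA; rewrite /= inE sZ orbT.
have AS' := intersections_member _ AS.
move=> /(_ sA' (intersections_setI _ _ AY AS') (intersections_setI _ _ AM AS')).
by move=> /(_ (@setSI _ S Y M YM)); lia.
Qed.

End Arrangement.

(** * The lattice of intersections *)

Section IntersectionLattice.
Context {R : realType} {K : cw_complex R} {d : int} {A : set (set K)}.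
Hypothesis hA : sphere_arrangement A d.
Implicit Types x y z m j : intersection_lattice A.

Definition flat X (AX : intersections A X) : intersection_lattice A :=
  exist _ X (mem_set AX).

Lemma valA x : intersections A (val x).
Proof. exact: set_mem (valP x). Qed.

Lemma flat_leP x y : reflect (val y `<=` val x) (x <= y)%O.
Proof. exact: asboolP. Qed.

Lemma flat_ltP x y :
  reflect (val y `<=` val x /\ ~ val x `<=` val y) (x < y)%O.
Proof.
rewrite lt_leAnge; apply: (iffP andP) => -[].
- by move=> /flat_leP yx /flat_leP.
- by move=> yx nxy; split; apply/flat_leP.
Qed.

Lemma setT_least : is_least (flat setT intersections_setT).
Proof. by move=> x; apply/flat_leP. Qed.

Lemma is_leastE x : is_least x -> val x = setT.
Proof.
by move=> /(_ (flat _ intersections_setT))/flat_leP Tx; apply/seteqP; split.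
Qed.

Definition center : intersection_lattice A :=
  flat (\bigcap_(S in A) S) (intersections_bigcap A (@subset_refl _ A)).

Lemma center_greatest : is_greatest center.
Proof.
move=> x; apply/flat_leP; have [B BA <-] := valA x.
by move=> p Ap S /BA; exact: Ap.
Qed.

Lemma supremums_bigcap (B : set (intersection_lattice A)) z :
  val z = \bigcap_(x in B) val x -> supremums B z.
Proof.
move=> zB; split=> [x Bx|y By]; apply/flat_leP.
- by rewrite zB; exact: bigcap_inf.
- by rewrite zB; apply: sub_bigcap => x /By/flat_leP.
Qed.

Lemma join_setI x y :
  supremums [set x; y] (flat _ (intersections_setI _ _ (valA x) (valA y))).
Proof. by apply: supremums_bigcap; rewrite bigcap_setU !bigcap_set1. Qed.

(** Any intersection that contains [x] and [y] is cut out by members containing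
    [x] and [y], so the smallest candidate is the intersection of all these. *)
Lemma meet_exists x y : exists m, infimums [set x; y] m.
Proof.
pose B := [set S | A S /\ val x `|` val y `<=` S].
have AB : intersections A (\bigcap_(S in B) S).
  by apply: intersections_bigcap => S [].
exists (flat _ AB); split=> [z zxy|z zlb]; apply/flat_leP.
- apply: sub_bigcap => S [_ xyS] p zp; apply: xyS.
  by case: zxy zp => -> ?; [left | right].
- have xz : val x `<=` val z by apply/flat_leP/zlb; left.
  have yz : val y `<=` val z by apply/flat_leP/zlb; right.
  have [C CA Cz] := valA z.
  rewrite -Cz; apply: sub_bigcap => S CS; apply: bigcap_inf; split.
    exact: CA.
  have zS : val z `<=` S by rewrite -Cz; exact: bigcap_inf.
  by move=> p [/xz|/yz] /zS.
Qed.

(** The cut of [x] by a member that contains [y] but not [x] lies strictly above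
    [x] in the lattice order, and below or at [y], so it is [y]. *)
Lemma covered_by_dimension x y :
  covered_by x y -> dimension (val y) = dimension (val x) - 1.
Proof.
move=> [/flat_ltP[yx nxy] nbetween].
have [S [AS yS nxS]] := intersections_separate _ _ (valA y) nxy.
rewrite -(dimension_cut hA _ _ (valA x) AS nxS); congr dimension.
apply/seteqP; split; first by rewrite subsetI.
pose z := flat _ (intersections_setI _ _ (valA x) (intersections_member _ AS)).
apply: contrapT => nzy; apply: (nbetween z); apply/andP; split; apply/flat_ltP.
- by split=> [|xz]; [exact: subIsetl | apply: nxS => p /xz[]].
- by split=> //=; rewrite subsetI.
Qed.

(** A proper intersection [z] containing [S] lies in some member [Y]; then [S]
    is contained in [Y], which forces [S = Y] and leaves no room for [z]. *)
Lemma member_atom S (AS : A S) : atom (flat S (intersections_member _ AS)).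
Proof.
exists (flat _ intersections_setT); first exact: setT_least.
split=> [|z /andP[/flat_ltP[_ nTz] /flat_ltP[/= Sz nzS]]].
  apply/flat_ltP; split=> //= TS; have := dimension_member hA _ AS.
  have -> : S = setT by apply/seteqP; split.
  by rewrite (dimension_setT hA); lia.
have [Y [AY zY _]] := intersections_separate _ _ (valA z) nTz.
by apply: nzS; rewrite (member_subset_eq hA _ _ AS AY (subset_trans Sz zY)).
Qed.

Lemma join_of_atoms x :
  exists2 B : set (intersection_lattice A), B `<=` @atom _ _ & supremums B x.
Proof.
have [C CA Cx] := valA x.
exists [set y |
    exists S (AS : A S), C S /\ y = flat S (intersections_member _ AS)].
  by move=> _ [S [AS [_ ->]]]; exact: member_atom.
apply: supremums_bigcap; rewrite -Cx; apply/seteqP; split=> p Cp.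
- by move=> _ [S [AS [CS ->]]]; exact: Cp.
- move=> S CS; apply: (Cp (flat S (intersections_member _ (CA _ CS)))).
  by exists S, (CA _ CS).
Qed.

(** The members that cut [x] out of the meet [m] also cut [y] down to the
    intersection of [x] and [y]. *)
Lemma dimension_semimodular x y m j :
  infimums [set x; y] m -> supremums [set x; y] j ->
  dimension (val x) + dimension (val y) <=
  dimension (val m) + dimension (val j).
Proof.
move=> [mlb _] jsup.
have -> : val j = val x `&` val y.
  by rewrite (is_subset1_supremums jsup (join_setI x y)).
have xm : val x `<=` val m by apply/flat_leP/mlb; left.
have ym : val y `<=` val m by apply/flat_leP/mlb; right.
have := dimension_cuts_le hA _ _ _ (valA y) (valA m) (valA x) ym.
by rewrite (setIidr xm) (setIC (val y)); lia.
Qed.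

Lemma flats_finite : finite_set [set: intersection_lattice A].
Proof.
apply: (@sub_finite_set _ _ (val @^-1` intersections A)) => [x _|].
  exact: valA.
apply: finite_preimage; first by move=> x y _ _; exact: val_inj.
exact: intersections_finite (finite_arrangement hA).
Qed.

End IntersectionLattice.

Theorem proposition5p3 (R : realType) (K : cw_complex R) (d : int)
    (A : set (set K)) (hA : sphere_arrangement A d) :
  let r := fun X : intersection_lattice A => d - dimension (val X) in
  geometric_lattice r /\ (essential A -> lattice_rank r (d + 1)).
Proof.
move=> r; split; last first.
  move=> A0; exists center; first exact: center_greatest.
  by rewrite /r /= A0 dimension0 opprK.
split.
- exact: flats_finite hA.
- by exists (flat _ intersections_setT); exact: setT_least.
- by exists center; exact: center_greatest.
- exact: meet_exists.
- by move=> x y; eexists; exact: join_setI.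
- split=> [b /is_leastE bT|x y xy]; rewrite /r.
    by rewrite bT (dimension_setT hA) subrr.
  by rewrite (covered_by_dimension hA _ _ xy); lia.
- by move=> x _; exact: join_of_atoms hA x.
- move=> x y m j mxy jxy; rewrite /r.
  by have := dimension_semimodular hA _ _ _ _ mxy jxy; lia.
Qed.
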